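(* Let $X$ be a real Hilbert space, let $M_1,\dots,M_k$ be finitely many closed linear subspaces of $X$, let $M:=\bigcap_{l=1}^k M_l$, and let $x_0\in X$. Let $\{x_i\}_{i\ge 0}$, $\{\tilde x_i\}_{i\ge 0}$ be infinite sequences generated from $x_0$ by the Accelerated Projections algorithm. For each $i\ge 0$ and $l\in\{1,\dots,k\}$ let $\tilde v_{i,l},v_{i,l}\in M_l^\perp$ be vectors such that $$x_i-\tilde x_i=\sum_{l=1}^k\tilde v_{i,l}\quad\text{and}\quad \tilde x_i-x_{i+1}=\sum_{l=1}^k v_{i,l}$$ (such a representation is not unique). Suppose that: (A) There is a number $\bar p$ such that for all $l\in\{1,\dots,k\}$ and all $i>0$ there is an integer $p_i^l\in[0,\bar p]$ such that $\tilde x_{i+p_i^l}=P_{M_l}(x_{i+p_i^l})$. (B$'$) There is a number $K$ such that $$\sum_{l=1}^k\left[\|\tilde v_{i,l}\|^2+\|v_{i,l}\|^2\right]\le K\left[\|x_i-\tilde x_i\|^2+\|\tilde x_i-x_{i+1}\|^2\right]\quad\text{for all } i\ge 0.$$ Then the iterates $\{x_i\}$ converge strongly (i.e. in norm) to $P_M(x_0)$.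
   Context: For a closed linear (or affine) subspace $N$ of $X$, $P_N$ denotes the orthogonal projection onto $N$, and for a linear subspace $N$, $N^\perp$ denotes its orthogonal complement. Accelerated Projections algorithm: given closed linear subspaces $M_1,\dots,M_k$ of $X$ and a starting point $x_0\in X$, for $i=0,1,2,\dots$ (run indefinitely): Step 1: choose $l_i\in\{1,\dots,k\}$ and set $\tilde x_i:=P_{M_{l_i}}(x_i)$. Put $a_i:=x_i-P_{M_{l_i}}(x_i)\in X$, $b_i:=\langle a_i,P_{M_{l_i}}(x_i)\rangle\in\mathbb{R}$, and $H_i:=\{x\in X:\langle a_i,x\rangle=b_i\}$ (so $M\subset M_{l_i}\subset H_i$; when $a_i=0$, $H_i=X$). Step 2: choose $J_i\subset\{0,1,\dots,i\}$ with $i\in J_i$, put $\tilde H_i:=\bigcap_{j\in J_i}H_j$, and set $x_{i+1}:=P_{\tilde H_i}(\tilde x_i)$. *)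

(* Defs.v *)
From HB Require Import structures.
From mathcomp Require Import all_boot all_order all_algebra sesquilinear.
From mathcomp Require Import all_classical all_reals all_analysis.

Set Implicit Arguments.
Unset Strict Implicit.
Unset Printing Implicit Defensive.

Import Order.TTheory GRing.Theory Num.Theory.
Import numFieldNormedType.Exports.
Local Open Scope classical_set_scope.
Local Open Scope ring_scope.

Section Hilbert.
Context {R : realType} {X : completeNormedModType R}.
Implicit Types (dot : {dot X for idfun}) (N : set X) (x y z : X).

(* A complete normed module is a real Hilbert space when its norm is the one
   induced by a (symmetric, bilinear, positive definite) dot product. *)
Definition hilbert_norm dot : Prop := forall x, `|x| = Num.sqrt (dot x x).

Definition closed_subspace N : Prop := submod_closed [in N] /\ closed N.

Definition ortho_compl dot N : set X :=
  [set x | forall y, N y -> dot x y = 0].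

(* [z - y] ranges over the direction space of [N], so this covers linear and
   affine subspaces alike. *)
Definition is_orth_proj dot N x y : Prop :=
  N y /\ forall z, N z -> dot (x - y) (z - y) = 0.

(* The default value 0 is irrelevant for a nonempty closed affine subspace of a
   Hilbert space, where the projection exists and is unique. *)
Definition orth_proj dot N x : X := xget 0 [set y | is_orth_proj dot N x y].

End Hilbert.

Section AcceleratedProjections.
Context {R : realType} {X : completeNormedModType R}.
Variables (dot : {dot X for idfun}) (k : nat) (M : 'I_k -> set X).
Variables (l : nat -> 'I_k) (J : nat -> set nat) (x xt : nat -> X).

Definition ap_a (i : nat) : X := x i - orth_proj dot (M (l i)) (x i).

Definition ap_b (i : nat) : R := dot (ap_a i) (orth_proj dot (M (l i)) (x i)).

Definition ap_H (i : nat) : set X := [set z | dot (ap_a i) z = ap_b i].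

Definition ap_Ht (i : nat) : set X := \bigcap_(j in J i) ap_H j.

Definition accelerated_projections (x0 : X) : Prop :=
  x 0%N = x0 /\
  forall i : nat,
    [/\ xt i = orth_proj dot (M (l i)) (x i),
        (forall j, J i j -> (j <= i)%N),
        J i i
      & x i.+1 = orth_proj dot (ap_Ht i) (xt i)].

End AcceleratedProjections.

(* Main.v *)
Require Import Defs.
From HB Require Import structures.
From mathcomp Require Import all_boot all_order all_algebra sesquilinear.
From mathcomp Require Import all_classical all_reals all_analysis.
From mathcomp Require Import ring lra.

(** The idea is that of Kaczmarz-type arguments.  Each iteration applies two
    orthogonal projections onto closed linear subspaces containing the
    intersection M of the M_l: the hyperplanes H_j pass through 0, because
    a_j is orthogonal to the projection of x_j.  By Pythagoras
    s_n^2 := |x_n - xt_n|^2 + |xt_n - x_(n+1)|^2 = |x_n|^2 - |x_(n+1)|^2,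
    so the series of the s_n^2 converges ([sqr_norm_step]), and x_n - x_0 stays
    orthogonal to M ([dot_step]).  Hence, once x_n is known to converge to a
    point of M, that point is the projection of x_0 ([ap_limit]).

    Norm convergence is the real issue.  For m <= j,
    |x_m - x_j|^2 = |x_m|^2 - |x_j|^2 - 2 <x_m - x_j, x_j>,
    and x_m - x_j is a sum of vectors, each orthogonal to one M_l.  The inner
    product of such a vector w with x_j is at most |w| times the distance from
    x_j to M_l, and by (A) this distance is at most twice the sum of s over a
    block of bounded length q starting at j ([dot_ortho_le]).  By (B') the
    vectors w occurring at step i have total norm at most a multiple of s_i.
    The cross term is therefore at most a constant times
    (sum of s_i for i < j) * (sum of s_i for j <= i < j + q)  ([cross]).
    This product need not tend to 0, but its liminf is 0 for every
    square-summable s ([liminf_sum_block]), and this suffices to make x a Cauchy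
    sequence ([cvgn_cross_term]). *)

Set Implicit Arguments.
Unset Strict Implicit.
Unset Printing Implicit Defensive.

Import Order.TTheory GRing.Theory Num.Theory.
Import numFieldNormedType.Exports.
Local Open Scope classical_set_scope.
Local Open Scope ring_scope.

(** * Square-summable sequences of reals *)

Section SquareSummable.
Context {R : realType}.
Implicit Types (s : nat -> R) (e : R).

(** Cauchy-Schwarz against the constant sequence 1. *)
Lemma sqr_sum_le s (n : nat) :
  (\sum_(0 <= i < n) s i) ^+ 2 <= n%:R * \sum_(0 <= i < n) s i ^+ 2.
Proof.
case: n => [|n]; first by rewrite !big_geq// expr0n mul0r.
set N : R := n.+1%:R; set T := \sum_(0 <= i < n.+1) s i.
have N0 : 0 < N by rewrite ltr0n.
have : 0 <= \sum_(0 <= i < n.+1) (N * s i - T) ^+ 2.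
  by apply: sumr_ge0 => i _; exact: sqr_ge0.
have -> : \sum_(0 <= i < n.+1) (N * s i - T) ^+ 2 =
    \sum_(0 <= i < n.+1) (N ^+ 2 * s i ^+ 2 + (- (2 * N * T)) * s i + T ^+ 2).
  by apply: eq_bigr => i _; ring.
rewrite !big_split/= -!mulr_sumr -/T sumr_const_nat subn0 -mulr_natl -/N.
set Q := \sum_(0 <= i < n.+1) s i ^+ 2 => h.
rewrite -(ler_pM2l N0); lra.
Qed.

(** If the conclusion failed beyond some index, then along blocks of length
    [q] the partial sums U_n would satisfy U_n * (U_(n+1) - U_n) > e, hence
    grow at least like the square root of 2 e n.  But Cauchy-Schwarz bounds the
    growth by the square root of n q d, where d is a tail of the series of
    squares, which can be made smaller than e / q. *)
Lemma liminf_sum_block s (q : nat) e (n0 : nat) :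
  (forall n, 0 <= s n) -> cvgn (series (fun n => s n ^+ 2)) -> 0 < e ->
  exists2 j, (n0 <= j)%N &
    (\sum_(0 <= m < j) s m) * (\sum_(j <= m < j + q) s m) <= e.
Proof.
move=> s0 cs e0; apply: contrapT => hno.
have hgt j : (n0 <= j)%N ->
    e < (\sum_(0 <= m < j) s m) * (\sum_(j <= m < j + q) s m).
  by move=> nj; rewrite ltNge; apply/negP => h; apply: hno; exists j.
have q0 : (0 < q)%N.
  case: q hgt {hno} => // /(_ n0 (leqnn _)).
  by rewrite addn0 (@big_geq _ _ _ n0 n0)// mulr0 ltNge (ltW e0).
have qR0 : 0 < q%:R :> R by rewrite ltr0n.
have [n1 n01 tail] : exists2 n1, (n0 <= n1)%N & forall n, (n1 <= n)%N ->
    \sum_(n1 <= m < n) s m ^+ 2 <= e / q%:R.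
  have nd : nondecreasing_seq (series (fun n => s n ^+ 2)).
    by apply: nondecreasing_series => n _ _; exact: sqr_ge0.
  have /cvgrPdist_le /(_ (e / q%:R)) := cs.
  case=> [|N _ hN]; first by rewrite divr_gt0.
  exists (maxn n0 N); first exact: leq_maxl.
  move=> n nn; rewrite -sub_series_geq//.
  have := hN (maxn n0 N) (leq_maxr _ _) => /=.
  have lim n' :
      series (fun n => s n ^+ 2) n' <= limn (series (fun n => s n ^+ 2)).
    exact: nondecreasing_cvgn_le.
  by rewrite ger0_norm ?subr_ge0//; have := lim n; lra.
pose U n := \sum_(0 <= m < n1 + n * q) s m.
have US n : U n.+1 = U n + \sum_(n1 + n * q <= m < n1 + n * q + q) s m.
  rewrite /U mulSn addnCA addnC.
  by rewrite (@big_cat_nat _ _ _ (n1 + n * q) 0 (n1 + n * q + q))//= leq_addr.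
have U0 n : 0 <= U n by apply: sumr_ge0.
(* U^2 grows at least linearly, as
   U_(n+1)^2 >= U_n^2 + 2 U_n (U_(n+1) - U_n) *)
have low n : 2 * e * n%:R <= U n ^+ 2.
  elim: n => [|n IH]; first by rewrite mulr0 sqr_ge0.
  have := hgt (n1 + n * q)%N (leq_trans n01 (leq_addr _ _)).
  rewrite -/(U n) US; set u := \sum_(n1 + n * q <= m < _) s m => hu.
  have := sqr_ge0 u; rewrite -natr1; nra.
(* the increments of U cover [n * q] terms of s, whose squares sum to at most
   [e / q] *)
have up n : (U n - U 0%N) ^+ 2 <= n%:R * e.
  have -> : U n - U 0%N = \sum_(0 <= i < n * q) s (n1 + i)%N.
    rewrite /U mul0n addn0 (@big_cat_nat _ _ _ n1 0 (n1 + n * q))//= ?leq_addr//.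
    rewrite addrAC subrr add0r -{1}[n1]add0n big_addn addKn.
    by apply: eq_bigr => i _; rewrite addnC.
  apply: le_trans (sqr_sum_le _ _) _.
  have := tail (n1 + n * q)%N (leq_addr _ _).
  rewrite -{1}[n1]add0n big_addn addKn.
  under eq_bigr do rewrite addnC.
  move=> /(ler_wpM2l (ler0n R (n * q))) /le_trans; apply.
  rewrite natrM le_eqVlt; apply/orP; left; apply/eqP.
  by have := lt0r_neq0 qR0 => ?; field.
(* the two bounds give 2 n e <= (c + sqrt (n e))^2, which fails for large n:
   concretely U^2 <= 3/2 (U - c)^2 + 3 c^2 *)
pose c := U 0%N.
have [n hn] : exists n : nat, 8 * c ^+ 2 / e < n%:R.
  exists (Num.bound (8 * c ^+ 2 / e)).
  by apply/archi_boundP/divr_ge0; [rewrite mulr_ge0 ?sqr_ge0|exact: ltW].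
have hn' : 8 * c ^+ 2 < n%:R * e by rewrite -ltr_pdivrMr.
have := low n; have := up n; rewrite -/c; have := sqr_ge0 (U n - 3 * c).
have := sqr_ge0 c.
lra.
Qed.

End SquareSummable.

(** * Projections and convergence in a real Hilbert space *)

Section RealHilbert.
Context {R : realType} {X : completeNormedModType R} (dot : {dot X for idfun})
  (hX : hilbert_norm dot).
Implicit Types (N : set X) (a w x y z : X).

Lemma dotC x y : dot x y = dot y x.
Proof. by rewrite (@hermC _ _ idfun) expr0 mul1r. Qed.

Lemma dot_ge0 x : 0 <= dot x x.
Proof.
have [->|x0] := eqVneq x 0; first by rewrite linear0l.
exact/ltW/neq0_dnorm_gt0.
Qed.

Lemma sqr_norm x : `|x| ^+ 2 = dot x x.
Proof. by rewrite hX sqr_sqrtr ?dot_ge0. Qed.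

Lemma sqr_normD x y : `|x + y| ^+ 2 = `|x| ^+ 2 + 2 * dot x y + `|y| ^+ 2.
Proof. by rewrite !sqr_norm linearDl !linearDr/= (dotC y x); ring. Qed.

Lemma sqr_normB x y : `|x - y| ^+ 2 = `|x| ^+ 2 - 2 * dot x y + `|y| ^+ 2.
Proof. by rewrite sqr_normD normrN linearNr/=; ring. Qed.

Lemma dotZr a (c : R) x : dot a (c *: x) = c * dot a x.
Proof. exact: linearZr_LR. Qed.

Lemma sqr_normZ (c : R) x : `|c *: x| ^+ 2 = c ^+ 2 * `|x| ^+ 2.
Proof. by rewrite normrZ exprMn real_normK ?num_real. Qed.

Lemma norm_dot_le x y : `|dot x y| <= `|x| * `|y|.
Proof.
have [->|y0] := eqVneq y 0; first by rewrite linear0r !normr0 mulr0.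
rewrite -ler_sqr ?nnegrE ?mulr_ge0// exprMn real_normK ?num_real//.
pose D : R := dot x y; pose Y : R := `|y| ^+ 2.
have Y0 : 0 < Y by rewrite exprn_gt0 ?normr_gt0.
have := sqr_ge0 `|Y *: x - D *: y|.
rewrite sqr_normB !sqr_normZ dotZr dotC dotZr (dotC y x) -/D -/Y => h.
by rewrite -(ler_pM2l Y0); lra.
Qed.

Lemma cvg_dotr (T : Type) (F : set_system T) {FF : Filter F} (u : T -> X) a y :
  u t @[t --> F] --> y -> dot a (u t) @[t --> F] --> dot a y.
Proof.
move=> uy; apply/cvgrPdist_le => e e0.
have a1 : 0 < `|a| + 1 by rewrite ltr_wpDl.
have /cvgrPdist_le /(_ (e / (`|a| + 1))) := uy.
rewrite divr_gt0// => /(_ isT); apply: filterS => t ht.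
rewrite -linearBr; apply: le_trans (norm_dot_le _ _) _.
rewrite -(divfK (lt0r_neq0 a1) e) mulrC ler_pM// lerDl//.
Qed.

Lemma ortho_eq0 x : dot x x = 0 -> x = 0.
Proof. by rewrite -sqr_norm => /eqP; rewrite sqrf_eq0 normr_eq0 => /eqP. Qed.

Lemma is_orth_proj_unique N x y z :
  is_orth_proj dot N x y -> is_orth_proj dot N x z -> y = z.
Proof.
move=> [Ny hy] [Nz hz]; apply/eqP; rewrite -subr_eq0; apply/eqP/ortho_eq0.
have {2}-> : y - z = (x - z) - (x - y) by rewrite opprB [RHS]addrC addrA subrK.
rewrite linearBr/= dotC hz// -(opprB z y) dotC linearNr/=.
by rewrite hy// oppr0 subr0.
Qed.

Lemma orth_projE N x y : is_orth_proj dot N x y -> orth_proj dot N x = y.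
Proof.
move=> h; apply/esym/(is_orth_proj_unique h).
by apply: (@xgetPex _ _ [set y | is_orth_proj dot N x y]); exists y.
Qed.

Lemma closed_subspace0 N : closed_subspace N -> N 0.
Proof. by case=> -[+ _] _; rewrite inE. Qed.

Lemma closed_subspaceP N (c : R) x y :
  closed_subspace N -> N x -> N y -> N (c *: x + y).
Proof.
by case=> -[_ h] _ Nx Ny; have := h c x y; rewrite !inE; exact.
Qed.

Lemma closed_subspaceZ N (c : R) x : closed_subspace N -> N x -> N (c *: x).
Proof.
move=> hN Nx; rewrite -[_ *: _]addr0.
exact: closed_subspaceP (closed_subspace0 hN).
Qed.

Lemma closed_subspaceB N x y : closed_subspace N -> N x -> N y -> N (x - y).
Proof. by move=> hN Nx Ny; rewrite addrC -scaleN1r; exact: closed_subspaceP. Qed.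

Lemma closed_subspace_bigcap (I : Type) (A : set I) (N : I -> set X) :
  (forall i, A i -> closed_subspace (N i)) ->
  closed_subspace (\bigcap_(i in A) N i).
Proof.
move=> hN; split; last by apply: closed_bigI => i /hN[].
split=> [|c x y]; rewrite !inE.
  by move=> i Ai; apply: closed_subspace0; exact: hN.
move=> Nx Ny i Ai.
by apply: closed_subspaceP; [exact: hN|exact: Nx|exact: Ny].
Qed.

Lemma closed_hyperplane a : closed_subspace [set z | dot a z = 0].
Proof.
split; last first.
  have -> : [set z | dot a z = 0] = (dot a : X -> R) @^-1` [set 0] by [].
  have /continuous_closedP : continuous (dot a : X -> R).
    by move=> z; exact: cvg_dotr.
  by apply; exact: closed_eq.
split=> [|c y z]; rewrite !inE/= ?linear0r//.
by move=> hy hz; rewrite linearDr/= dotZr hy hz mulr0 addr0.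
Qed.

Lemma cvgn_cauchy (u : nat -> X) :
  (forall e : R, 0 < e -> exists n0, forall m n, (n0 <= m)%N -> (n0 <= n)%N ->
     `|u m - u n| <= e) -> cvgn u.
Proof.
move=> hu; apply: cauchy_cvg; apply: cauchy_exP => e e0.
have [n0 hn0] := hu (e / 2) (divr_gt0 e0 (ltr0n _ 2)).
exists (u n0), n0 => // n /= n0n; rewrite -ball_normE/=.
by apply: le_lt_trans (hn0 _ _ _ n0n) _ => //; rewrite ltr_pdivrMr//; lra.
Qed.

(** The projection theorem: a minimizing sequence for the distance from [x] to
    [N] is Cauchy, and its limit satisfies the first-order optimality condition. *)
Lemma is_orth_projP N x :
  closed_subspace N -> is_orth_proj dot N x (orth_proj dot N x).
Proof.
move=> hN.
suff [y hy] : exists y, is_orth_proj dot N x y by rewrite (orth_projE hy).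
pose E : set R := [set `|x - z| ^+ 2 | z in N].
have Einf : has_inf E.
  split; first by exists (`|x - 0| ^+ 2), 0 => //; exact: closed_subspace0.
  by exists 0 => _ [z _ <-]; exact: sqr_ge0.
have leE z : N z -> inf E <= `|x - z| ^+ 2.
  by move=> Nz; apply: inf_lbound; [case: Einf|exists z].
pose eps (n : nat) : R := n.+1%:R^-1.
have /boolp.choice[u hu] : forall n : nat, exists z : X,
    N z /\ `|x - z| ^+ 2 < inf E + eps n.
  move=> n; have [|_ [z Nz <-] hz] := @inf_adherent _ E (eps n) _ Einf.
    by rewrite invr_gt0 ltr0n.
  by exists z.
(* parallelogram identity: the midpoint of [u m] and [u n] lies in [N], so it is
   at squared distance at least [inf E] from [x] *)
have upar m n : `|u m - u n| ^+ 2 <= 2 * eps m + 2 * eps n.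
  have [Nm hm] := hu m; have [Nn hn] := hu n.
  pose z := 2^-1 *: u m + 2^-1 *: u n.
  have Nz : N z by apply: closed_subspaceP => //; exact: closed_subspaceZ.
  have xz : x - z = 2^-1 *: ((x - u m) + (x - u n)).
    rewrite addrACA -opprD scalerBr scalerDr -!scalerDl.
    have -> : 2^-1 + 2^-1 = 1 :> R by lra.
    by rewrite scale1r scalerDr.
  have umn : u m - u n = (x - u n) - (x - u m).
    by rewrite opprB [RHS]addrC addrA subrK.
  have := leE _ Nz; rewrite xz umn sqr_normZ.
  rewrite (sqr_normD (x - u m)) (sqr_normB (x - u n)) (dotC (x - u n)).
  by lra.
have /cvg_ex[y uy] : cvgn u.
  apply: cvgn_cauchy => e e0.
  have [n0 hn0] : exists n0 : nat, 4 / e ^+ 2 < n0%:R.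
    by exists (Num.bound (4 / e ^+ 2)); rewrite archi_boundP// divr_ge0// sqr_ge0.
  have small n : (n0 <= n)%N -> 2 * eps n <= e ^+ 2 / 2.
    move=> n0n; have n1 : 0 < n.+1%:R :> R by rewrite ltr0n.
    have n0n' : n0%:R <= n.+1%:R :> R by rewrite ler_nat ltnW.
    rewrite /eps ler_pdivrMr//; have := lt_le_trans hn0 n0n'.
    by rewrite ltr_pdivrMr ?exprn_gt0//; lra.
  exists n0 => m n n0m n0n; rewrite -ler_sqr ?nnegrE ?(ltW e0)//.
  have := upar m n; have := small m n0m; have := small n n0n; lra.
have Ny : N y.
  case: hN => _ cN; apply: (closed_cvg N cN _ y uy).
  by apply: nearW => n; have [] := hu n.
(* passing to the limit in the first-order condition for [u n] avoids showing
   that the infimum is attained at [y] *)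
have oy w : N w -> dot w (x - y) = 0.
  move=> Nw; have [->|w0] := eqVneq w 0; first by rewrite linear0l.
  have W0 : 0 < `|w| ^+ 2 by rewrite exprn_gt0 ?normr_gt0.
  have h n : dot w (x - u n) ^+ 2 <= `|w| ^+ 2 * eps n.
    have [Nn hn] := hu n; set c := dot w (x - u n).
    (* this multiple of [w] gives the largest decrease of the distance *)
    have Nz : N ((c / `|w| ^+ 2) *: w + u n) by exact: closed_subspaceP.
    have := leE _ Nz; rewrite opprD addrA addrAC sqr_normB sqr_normZ dotZr.
    rewrite (dotC _ w) -/c.
    set W := `|w| ^+ 2 in W0 * => le.
    have : c ^+ 2 / W <= eps n.
      have -> : c ^+ 2 / W = 2 * (c / W * c) - (c / W) ^+ 2 * W.
        by have := lt0r_neq0 W0 => ?; field.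
      lra.
    by rewrite ler_pdivrMr// mulrC.
  have cc : dot w (x - u n) ^+ 2 @[n --> \oo] --> dot w (x - y) ^+ 2.
    have cv : dot w (x - u n) @[n --> \oo] --> dot w (x - y).
      by apply: cvg_dotr; apply: cvgB => //; exact: cvg_cst.
    by rewrite expr2; apply: cvgM.
  have c0 : `|w| ^+ 2 * eps n @[n --> \oo] --> `|w| ^+ 2 * 0.
    by apply: cvgMr; exact: cvg_harmonic.
  have : dot w (x - y) ^+ 2 <= `|w| ^+ 2 * 0.
    by apply: ler_cvg_to cc c0 _; exact: nearW.
  by rewrite mulr0 => le0; apply/eqP; rewrite -sqrf_eq0 eq_le le0 sqr_ge0.
exists y; split=> // z Nz; rewrite dotC; apply: oy; exact: closed_subspaceB.
Qed.

Lemma is_orth_proj_subspaceP N x y : closed_subspace N ->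
  is_orth_proj dot N x y <-> N y /\ forall z, N z -> dot (x - y) z = 0.
Proof.
move=> hN; split=> -[Ny h]; split=> // z Nz.
  rewrite -[z](addrK y); apply: h; rewrite addrC -[y]scale1r.
  exact: closed_subspaceP.
by apply: h; exact: closed_subspaceB.
Qed.

(** Expanding the square,
    |x m - x j|^2 = |x m|^2 - |x j|^2 - 2 <x m - x j, x j>.
    The norms form a Cauchy sequence, and the cross term is small for
    arbitrarily large j; comparing two late terms with a common such j shows
    that the whole sequence is Cauchy. *)
Lemma cvgn_cross_term (x : nat -> X) (s : nat -> R) (q : nat) (C : R) :
  (forall n, 0 <= s n) ->
  (forall n, s n ^+ 2 = `|x n| ^+ 2 - `|x n.+1| ^+ 2) ->
  (forall m j, (0 < j)%N -> (m <= j)%N -> `|dot (x m - x j) (x j)| <=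
     C * ((\sum_(0 <= i < j) s i) * (\sum_(j <= i < j + q) s i))) ->
  cvgn x.
Proof.
move=> s0 sE cross; pose g n : R := `|x n| ^+ 2.
have gS n : g n.+1 <= g n by rewrite -subr_ge0 -sE sqr_ge0.
have gdec : nonincreasing_seq g by apply/nonincreasing_seqP.
have cg : cvgn g.
  apply: nonincreasing_is_cvgn => //.
  by exists 0 => _ [n _ <-]; exact: sqr_ge0.
have cs : cvgn (series (fun n => s n ^+ 2)).
  have -> : series (fun n => s n ^+ 2) = (fun n => g 0%N - g n).
    apply/funext => n; rewrite /series/=.
    under eq_bigr do rewrite sE.
    rewrite -[RHS]opprB -(telescope_sumr g)// -sumrN.
    by apply: eq_bigr => i _; rewrite opprB.
  by apply: is_cvgB => //; exact: is_cvg_cst.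
apply: cvgn_cauchy => e e0.
(* |x i - x j|^2 is bounded by 2 d from the norms plus 2 d from the cross term;
   4 d is the square of e / 2 *)
pose d := e ^+ 2 / 16.
have d0 : 0 < d by rewrite divr_gt0// exprn_gt0.
have C0 : 0 < `|C| + 1 by rewrite ltr_wpDl.
have /cvgrPdist_le /(_ d d0) [N _ hN] := cg.
exists N => m n Nm Nn.
have [j mnj small] :=
  liminf_sum_block q (maxn m n).+1 s0 cs (divr_gt0 d0 C0).
have close i : (N <= i)%N -> (i <= maxn m n)%N ->
    `|x i - x j| ^+ 2 <= (e / 2) ^+ 2.
  move=> Ni imn.
  have ij : (i <= j)%N by apply: leq_trans imn (ltnW _).
  have := sqr_normD (x i - x j) (x j); rewrite subrK -/(g i) -/(g j).
  have := cross i j (leq_trans (ltn0Sn _) mnj) ij.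
  set P := _ * _ in small *; set D := dot _ _ => hD gE.
  have P0 : 0 <= P by rewrite mulr_ge0// sumr_ge0.
  have hP : (`|C| + 1) * P <= d by rewrite mulrC -ler_pdivlMr.
  have : C * P <= (`|C| + 1) * P.
    by rewrite ler_wpM2r//; have := ler_norm C; lra.
  have := hN i Ni; have := hN j (leq_trans Ni ij).
  have := ler_norm (- D); rewrite normrN.
  rewrite !ler_norml => ? /andP[? ?] /andP[? ?] ?.
  rewrite (_ : (e / 2) ^+ 2 = 4 * d); last by rewrite /d; field.
  lra.
rewrite (_ : x m - x n = (x m - x j) - (x n - x j)); last first.
  by rewrite opprB addrA subrK.
apply: le_trans (ler_normB _ _) _; rewrite [e]splitr.
have e2 : 0 <= e / 2 by rewrite divr_ge0// ltW.
by apply: lerD; rewrite -ler_sqr ?nnegrE//; apply: close;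
  rewrite ?leq_maxl ?leq_maxr.
Qed.

End RealHilbert.

(** * The accelerated projections iteration *)

Section Iteration.
Context {R : realType} {X : completeNormedModType R} (dot : {dot X for idfun})
  (hX : hilbert_norm dot).
Context (k : nat) (M : 'I_k -> set X) (hM : forall l, closed_subspace (M l)).
Context (x0 : X) (ls : nat -> 'I_k) (J : nat -> set nat) (x xt : nat -> X)
  (hx : accelerated_projections dot M ls J x xt x0).

Local Notation Mcap := (\bigcap_(l in [set: 'I_k]) M l).

Lemma xt_proj i : M (ls i) (xt i) /\
  forall z, M (ls i) z -> dot (x i - xt i) z = 0.
Proof.
have [_ /(_ i)[-> _ _ _]] := hx.
by apply/is_orth_proj_subspaceP => //; exact: is_orth_projP.
Qed.

(** [ap_b] vanishes, since the residual of a projection onto a linear subspace is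
    orthogonal to the projection: [ap_H] is a linear hyperplane. *)
Lemma ap_HE i : ap_H dot M ls x i = [set z | dot (x i - xt i) z = 0].
Proof.
have [Mxt ort] := xt_proj i; have [_ /(_ i)[xtE _ _ _]] := hx.
by rewrite /ap_H /ap_b /ap_a -xtE ort.
Qed.

Lemma ap_Ht_closed_subspace i : closed_subspace (ap_Ht dot M ls J x i).
Proof.
apply: closed_subspace_bigcap => j _; rewrite ap_HE.
exact: closed_hyperplane.
Qed.

Lemma sub_ap_Ht i : Mcap `<=` ap_Ht dot M ls J x i.
Proof.
by move=> z Mz j _; rewrite ap_HE; apply: (xt_proj j).2; exact: Mz.
Qed.

Lemma xS_proj i : ap_Ht dot M ls J x i (x i.+1) /\
  forall z, ap_Ht dot M ls J x i z -> dot (xt i - x i.+1) z = 0.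
Proof.
have [_ /(_ i)[_ _ _ ->]] := hx.
apply/is_orth_proj_subspaceP => //; first exact: ap_Ht_closed_subspace.
by apply: is_orth_projP => //; exact: ap_Ht_closed_subspace.
Qed.

(** Pythagoras for the two projections onto linear subspaces. *)
Lemma sqr_norm_step i :
  `|x i - xt i| ^+ 2 + `|xt i - x i.+1| ^+ 2 = `|x i| ^+ 2 - `|x i.+1| ^+ 2.
Proof.
have [Mxt ort] := xt_proj i; have [Hx ortS] := xS_proj i.
have := sqr_normD hX (x i - xt i) (xt i); rewrite subrK ort//.
have := sqr_normD hX (xt i - x i.+1) (x i.+1); rewrite subrK ortS//.
lra.
Qed.

(** Both residuals of a step are orthogonal to the intersection of the [M l]. *)
Lemma dot_step z n : Mcap z -> dot z (x n) = dot z x0.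
Proof.
move=> Mz; have [x0E _] := hx; elim: n => [|n <-]; first by rewrite x0E.
have /eqP := (xt_proj n).2 z (Mz _ I).
have /eqP := (xS_proj n).2 z (sub_ap_Ht Mz).
by rewrite !linearBl/= !subr_eq0 !(dotC _ z) => /eqP <- /eqP.
Qed.

(** The length of step [n], in the l2 sense; the sequence fed to
    [liminf_sum_block]. *)
Let s n : R := Num.sqrt (`|x n - xt n| ^+ 2 + `|xt n - x n.+1| ^+ 2).

Let s_ge0 n : 0 <= s n. Proof. exact: sqrtr_ge0. Qed.

Let sqr_s n : s n ^+ 2 = `|x n - xt n| ^+ 2 + `|xt n - x n.+1| ^+ 2.
Proof. by rewrite sqr_sqrtr// addr_ge0// sqr_ge0. Qed.

Let norm_xt_le n : `|x n - xt n| <= s n.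
Proof. by rewrite -ler_sqr ?nnegrE// sqr_s lerDl sqr_ge0. Qed.

Let norm_xS_le n : `|xt n - x n.+1| <= s n.
Proof. by rewrite -ler_sqr ?nnegrE// sqr_s lerDr sqr_ge0. Qed.

Let norm_xt_later j p :
  `|x j - xt (j + p)%N| <= 2 * \sum_(j <= m < j + p.+1) s m.
Proof.
rewrite addnS big_nat_recr ?leq_addr//= mulrDr.
have -> : x j - xt (j + p)%N =
    (x j - x (j + p)%N) + (x (j + p)%N - xt (j + p)%N).
  by rewrite addrA subrK.
apply: le_trans (ler_normD _ _) _; apply: lerD; last first.
  by apply: le_trans (norm_xt_le _) _; have := s_ge0 (j + p)%N; lra.
elim: p => [|p IH]; first by rewrite addn0 subrr normr0 big_geq ?mulr0.
rewrite addnS big_nat_recr ?leq_addr//= mulrDr.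
have -> : x j - x (j + p).+1 = (x j - x (j + p)%N) +
    ((x (j + p)%N - xt (j + p)%N) + (xt (j + p)%N - x (j + p).+1)).
  by rewrite !addrA !subrK.
apply: le_trans (ler_normD _ _) _; apply: lerD => //.
apply: le_trans (ler_normD _ _) _; rewrite mulr_natl mulr2n.
exact: lerD.
Qed.

Context (vt v : nat -> 'I_k -> X)
  (hvt : forall i l, ortho_compl dot (M l) (vt i l))
  (hv : forall i l, ortho_compl dot (M l) (v i l))
  (hvt_sum : forall i, x i - xt i = \sum_(l < k) vt i l)
  (hv_sum : forall i, xt i - x i.+1 = \sum_(l < k) v i l).
Context (pbar : nat)
  (hA : forall (l : 'I_k) (i : nat), (0 < i)%N -> exists p : nat,
    (p <= pbar)%N /\ xt (i + p)%N = orth_proj dot (M l) (x (i + p)%N)).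
Context (K : R) (hB : forall i : nat,
  \sum_(l < k) (`|vt i l| ^+ 2 + `|v i l| ^+ 2)
    <= K * (`|x i - xt i| ^+ 2 + `|xt i - x i.+1| ^+ 2)).

Let xt_mem l i : (0 < i)%N -> exists2 p, (p <= pbar)%N & M l (xt (i + p)%N).
Proof.
move=> i0; have [p [hp xtE]] := hA l i0; exists p => //; rewrite xtE.
by have [] := is_orth_projP hX (x (i + p)%N) (hM l).
Qed.

(** As [w] is orthogonal to [M l], [x j] may be replaced by its difference with
    any point of [M l]; condition (A) puts some [xt (j + p)] with [p <= pbar] in
    [M l]. *)
Let dot_ortho_le l w j : ortho_compl dot (M l) w -> (0 < j)%N ->
  `|dot w (x j)| <= `|w| * (2 * \sum_(j <= m < j + pbar.+1) s m).
Proof.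
move=> hw j0; have [p hp Mp] := xt_mem l j0.
have -> : dot w (x j) = dot w (x j - xt (j + p)%N).
  by rewrite linearBr/= (hw _ Mp) subr0.
apply: le_trans (norm_dot_le hX _ _) _; apply: ler_wpM2l => //.
apply: le_trans (norm_xt_later _ _) _; rewrite ler_pM2l//.
rewrite [leRHS](@big_cat_nat _ _ _ (j + p.+1))/= ?leq_addr ?leq_add2l//.
by rewrite lerDl sumr_ge0.
Qed.

(** The constant comes from [K <= (`|K| + 1) ^+ 2], which holds for either sign
    of [K]. *)
Let norm_summand_le i l : `|vt i l| + `|v i l| <= 2 * (`|K| + 1) * s i.
Proof.
have h : `|vt i l| ^+ 2 + `|v i l| ^+ 2 <= ((`|K| + 1) * s i) ^+ 2.
  have := hB i; rewrite (bigD1 l)//= -sqr_s => hi.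
  have le1 : `|vt i l| ^+ 2 + `|v i l| ^+ 2 <= K * s i ^+ 2.
    apply: le_trans hi; rewrite lerDl; apply: sumr_ge0 => m _.
    by apply: addr_ge0; exact: sqr_ge0.
  apply: le_trans le1 _; rewrite exprMn ler_wpM2r ?sqr_ge0//.
  by have := ler_norm K; have := normr_ge0 K; nra.
have c0 : 0 <= (`|K| + 1) * s i by rewrite mulr_ge0// addr_ge0.
rewrite -mulrA mulr_natl mulr2n; apply: lerD; rewrite -ler_sqr ?nnegrE//.
  by apply: le_trans h; rewrite lerDl sqr_ge0.
by apply: le_trans h; rewrite lerDr sqr_ge0.
Qed.

(** Expand [x m - x j] into the vectors [vt i l] and [v i l] with [m <= i < j]:
    [dot_ortho_le] bounds each inner product, [norm_summand_le] each norm. *)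
Let cross m j : (0 < j)%N -> (m <= j)%N -> `|dot (x m - x j) (x j)| <=
  (4 * k%:R * (`|K| + 1)) *
  ((\sum_(0 <= i < j) s i) * (\sum_(j <= i < j + pbar.+1) s i)).
Proof.
move=> j0 mj; set B := \sum_(j <= i < _) s i.
have B0 : 0 <= B by exact: sumr_ge0.
have -> : x m - x j = \sum_(m <= i < j) \sum_(l < k) (vt i l + v i l).
  rewrite -[LHS]opprB -(telescope_sumr x)// -sumrN; apply: eq_bigr => i _.
  by rewrite big_split/= -hvt_sum -hv_sum addrA subrK opprB.
rewrite linear_sumlz/=; apply: le_trans (ler_norm_sum _ _ _) _.
have -> : 4 * k%:R * (`|K| + 1) * ((\sum_(0 <= i < j) s i) * B) =
    \sum_(0 <= i < j) (4 * k%:R * (`|K| + 1) * B) * s i.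
  by rewrite -mulr_sumr; ring.
have pos i : 0 <= 4 * k%:R * (`|K| + 1) * B * s i.
  by rewrite !mulr_ge0// addr_ge0.
rewrite [leRHS](@big_cat_nat _ _ _ m)//= -[leLHS]add0r.
apply: lerD; first exact: sumr_ge0.
apply: ler_sum => i _; rewrite linear_sumlz/=.
apply: le_trans (ler_norm_sum _ _ _) _.
have -> : 4 * k%:R * (`|K| + 1) * B * s i =
    \sum_(l < k) (2 * (`|K| + 1) * s i) * (2 * B).
  by rewrite sumr_const card_ord -mulr_natr; ring.
apply: ler_sum => l _; rewrite linearDl/=.
apply: le_trans (ler_normD _ _) _.
have hvtj := dot_ortho_le (@hvt i l) j0; have hvj := dot_ortho_le (@hv i l) j0.
apply: le_trans (lerD hvtj hvj) _.
rewrite -mulrDl; apply: ler_wpM2r; first by rewrite mulr_ge0.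
exact: norm_summand_le.
Qed.

Lemma ap_cvgn : cvgn x.
Proof.
apply: (cvgn_cross_term hX s_ge0 _ cross) => n.
by rewrite sqr_s sqr_norm_step.
Qed.

(** Since [s] tends to 0, [xt] has the same limit as [x], and (A) provides a
    subsequence of [xt] in the closed set [M l]. *)
Lemma ap_limit_mem l : M l (limn x).
Proof.
have cx : x n @[n --> \oo] --> limn x := ap_cvgn.
have cg : `|x n| ^+ 2 - `|x n.+1| ^+ 2 @[n --> \oo] --> (0 : R).
  have cg : `|x n| ^+ 2 @[n --> \oo] --> (`|limn x| ^+ 2 : R).
    by rewrite expr2; apply: cvgM; exact: cvg_norm.
  rewrite -(subrr (`|limn x| ^+ 2)); apply: cvgB => //.
  by rewrite (cvg_shiftS (fun n => `|x n| ^+ 2 : R)).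
have cxt : xt n @[n --> \oo] --> limn x.
  apply/cvgrPdist_le => e e0; have e2 : 0 < e / 2 by rewrite divr_gt0.
  move/cvgrPdist_le : cx => /(_ _ e2).
  move/cvgrPdist_le : cg => /(_ _ (exprn_gt0 2 e2)).
  apply: filterS2 => n; rewrite sub0r normrN -sqr_norm_step -sqr_s => hs hxn.
  rewrite -(subrK (x n) (limn x)) -addrA [e]splitr.
  apply: le_trans (ler_normD _ _) _; apply: lerD => //.
  apply: le_trans (norm_xt_le n) _.
  by rewrite -ler_sqr ?nnegrE ?(ltW e2)//; apply: le_trans hs; exact: ler_norm.
have /boolp.choice[f hf] : forall n : nat, exists m, (n <= m)%N /\ M l (xt m).
  move=> n; have [p _ Mp] := xt_mem l (ltn0Sn n).
  by exists (n.+1 + p)%N; rewrite addSn leqW ?leq_addr.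
have f_oo : f n @[n --> \oo] --> \oo.
  by move=> A [N _ hN]; exists N => // n /= Nn; apply/hN/(leq_trans Nn)/(hf n).1.
have [_ cM] := hM l.
apply: (closed_cvg (M l) cM _ _ (cvg_comp _ _ f_oo cxt)).
by apply: nearW => n; exact: (hf n).2.
Qed.

Lemma ap_limit : is_orth_proj dot Mcap x0 (limn x).
Proof.
apply/is_orth_proj_subspaceP => //.
  exact: closed_subspace_bigcap.
split=> [l _|z Mz]; first exact: ap_limit_mem.
rewrite dotC linearBr/=; apply/eqP; rewrite subr_eq0; apply/eqP/esym.
have cz : dot z (x n) @[n --> \oo] --> dot z (limn x).
  by apply: cvg_dotr => //; exact: ap_cvgn.
apply: (cvg_unique _ cz) => //; rewrite (_ : (fun n => _) = cst (dot z x0)).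
  exact: cvg_cst.
by apply/funext => n; exact: dot_step.
Qed.

End Iteration.

Theorem theorem3p12 (R : realType) (X : completeNormedModType R)
    (dot : {dot X for idfun}) (hX : hilbert_norm dot)
    (k : nat) (M : 'I_k -> set X) (hM : forall l, closed_subspace (M l))
    (x0 : X) (ls : nat -> 'I_k) (J : nat -> set nat) (x xt : nat -> X)
    (hx : accelerated_projections dot M ls J x xt x0)
    (vt v : nat -> 'I_k -> X)
    (hvt : forall i l, ortho_compl dot (M l) (vt i l))
    (hv : forall i l, ortho_compl dot (M l) (v i l))
    (hvt_sum : forall i, x i - xt i = \sum_(l < k) vt i l)
    (hv_sum : forall i, xt i - x i.+1 = \sum_(l < k) v i l)
    (hA : exists pbar : nat, forall (l : 'I_k) (i : nat), (0 < i)%N ->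
       exists p : nat, (p <= pbar)%N /\
         xt (i + p)%N = orth_proj dot (M l) (x (i + p)%N))
    (hB : exists K : R, forall i : nat,
       \sum_(l < k) (`|vt i l| ^+ 2 + `|v i l| ^+ 2)
         <= K * (`|x i - xt i| ^+ 2 + `|xt i - x i.+1| ^+ 2)) :
  x @ \oo --> orth_proj dot (\bigcap_(l in [set: 'I_k]) M l) x0.
Proof.
have [pbar hpbar] := hA; have [K hK] := hB.
have := ap_limit hX hM hx hvt hv hvt_sum hv_sum hpbar hK.
move=> /(orth_projE hX) ->.
exact: (ap_cvgn hX hM hx hvt hv hvt_sum hv_sum hpbar hK).
Qed.
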